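(* For every $1\le p\le\infty$ there are arbitrarily large integers $n$ for which there exists an $n$-point subset $X$ of $L_p$ such that any linear embedding of $X$ into $L_2$ incurs distortion at least $$\left(\frac{n-1}{2}\right)^{\left|1/p-1/2\right|}.$$
   Context: $L_p$ denotes the real space $L_p[0,1]$ with its usual norm, and $1/\infty=0$. A linear embedding of a set $X\subseteq L_p$ into a normed space $Y$ is the restriction to $X$ of a linear operator $T:L_p\to Y$. Its distortion is the least $D$ such that for some $s>0$, $s\|x-y\|_p\le\|T(x)-T(y)\|_Y\le D s\|x-y\|_p$ for all $x,y\in X$ ($D=\infty$ if there is none). *)

(* Defs.v *)
From HB Require Import structures.
From mathcomp Require Import all_boot all_order all_algebra.
From mathcomp Require Import all_classical all_reals all_analysis.
From mathcomp Require Import measurable_realfun ess_sup_inf.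

Set Implicit Arguments.
Unset Strict Implicit.
Unset Printing Implicit Defensive.
Import Order.TTheory GRing.Theory Num.Theory.
Import numFieldNormedType.Exports.
Local Open Scope classical_set_scope.
Local Open Scope ring_scope.
Local Open Scope quotient_scope.

(* [LspaceType mu p1] is the library's type of a.e. classes of p-integrable
   functions, but the library gives it no linear or normed structure.  The
   operations below are those induced by the operations on representatives,
   and the norm of a class is the p-norm of a representative. *)
Section Lspace_normed.
Context d (T : measurableType d) (R : realType).
Variables (mu : {measure set T -> \bar R}) (p : \bar R) (p1 : (1 <= p)%E).
Local Notation Lf := (LfunType mu p1).
Local Notation Ls := (LspaceType mu p1).
Local Notation Q := {mfun_ mu, T >-> measurableTypeR R}.

Lemma Lnorm_ae (f g : T -> R) : measurable_fun setT f -> measurable_fun setT g ->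
  f = g %[ae mu] -> 'N[mu]_p[EFin \o f]%E = 'N[mu]_p[EFin \o g]%E.
Proof.
move=> mf mg fg; rewrite unlock; case: p p1 => [r r1|_|//]; last first.
  by case: ifP => // _; apply: eq_ess_sup; apply: filterS fg => x /(_ I) /= ->.
have mpow (h : T -> R) : measurable_fun setT h ->
    measurable_fun setT ((fun x => `|(EFin \o h) x| `^ r)%E : T -> \bar R).
  move=> mh; apply: (@measurableT_comp _ _ _ _ _ _ (fun x : \bar R => (x `^ r)%E)).
    exact: measurable_poweR.
  by apply: measurableT_comp => //; apply/measurable_EFinP.
congr (_ `^ _)%E; apply: ge0_ae_eq_integral => //.
- exact: mpow.
- exact: mpow.
- by move=> x _; rewrite poweR_ge0.
- by move=> x _; rewrite poweR_ge0.
- by apply: filterS fg => x /(_ I) /= -> _.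
Qed.

Lemma Lrepr_subproof (x : Ls) : (x : T -> R) \in Lfun mu p.
Proof.
rewrite inE; apply/andP; split; rewrite inE /=.
  exact: (@measurable_funPT _ _ _ _ (repr (x : Q))).
exact: (@Lebesgue_finite _ _ _ _ _ p1 x).
Qed.

Definition Lrepr (x : Ls) : Lf := Lfun_Sub p1 (Lrepr_subproof x).

Definition Lmfun (f : Lf) : {mfun T >-> measurableTypeR R} :=
  HB.pack_for {mfun T >-> measurableTypeR R} (f : T -> R)
   (@isMeasurableFun.Build _ _ T (measurableTypeR R) f (@measurable_funPT _ _ _ _ f)).

Definition Lpi_subdef (f : Lf) : Q := \pi_Q (Lmfun f).

Lemma Lpi_subdef_ae (f : Lf) : (Lpi_subdef f : T -> R) = f %[ae mu].
Proof.
have : repr (Lpi_subdef f) = Lmfun f %[mod Q] by rewrite reprK.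
by move/eqmodP/asboolP.
Qed.

Lemma Lpi_subproof (f : Lf) : finite_norm mu p (Lpi_subdef f : T -> R).
Proof.
rewrite /finite_norm (@Lnorm_ae _ f) //; first exact: Lfunction_finite.
- exact: (@measurable_funPT _ _ _ _ (repr (Lpi_subdef f))).
- exact: Lpi_subdef_ae.
Qed.

HB.instance Definition _ (f : Lf) :=
  isFinLebesgue.Build d T R mu p p1 (Lpi_subdef f) (Lpi_subproof f).

Definition Lpi (f : Lf) : Ls := Lpi_subdef f.

Lemma LpiE (f : Lf) : (Lpi f : T -> R) = f %[ae mu].
Proof. exact: Lpi_subdef_ae. Qed.

Lemma Lspace_eqP (x y : Ls) : x = y <-> (x : T -> R) = y %[ae mu].
Proof.
split=> [->//|]; first exact: ae_eq_refl.
move=> xy; have {xy} : (x : Q) = (y : Q).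
  by rewrite -[x : Q]reprK -[y : Q]reprK; apply/eqmodP/asboolP.
case: x y => [x [[x_fin]]] [y [[y_fin]]] /= xy.
by case: _ / xy y_fin => y_fin; rewrite (Prop_irrelevance y_fin x_fin).
Qed.

Lemma Lpi_eqP (f g : Lf) : Lpi f = Lpi g <-> f = g %[ae mu].
Proof.
split=> [fg|fg].
  apply: (ae_eq_trans (ae_eq_sym (LpiE f))); rewrite fg; exact: LpiE.
apply/Lspace_eqP; apply: (ae_eq_trans (LpiE f)); apply: (ae_eq_trans fg).
exact/ae_eq_sym/LpiE.
Qed.

Lemma LreprK : cancel Lrepr Lpi.
Proof. by move=> x; apply/Lspace_eqP; exact: LpiE. Qed.

HB.instance Definition _ := gen_eqMixin Ls.
HB.instance Definition _ := gen_choiceMixin Ls.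

Definition Lzero : Ls := Lpi 0.
Definition Lopp (x : Ls) : Ls := Lpi (- Lrepr x).
Definition Ladd (x y : Ls) : Ls := Lpi (Lrepr x + Lrepr y).
Definition Lscale (a : R) (x : Ls) : Ls := Lpi (a *: Lrepr x).

Lemma Lpi_opp (f : Lf) : Lopp (Lpi f) = Lpi (- f).
Proof. by apply/Lpi_eqP; apply: filterS (LpiE f) => x /(_ I) /= fx _; congr -%R. Qed.

Lemma Lpi_add (f g : Lf) : Ladd (Lpi f) (Lpi g) = Lpi (f + g).
Proof.
apply/Lpi_eqP; apply: filterS2 (LpiE f) (LpiE g) => x /(_ I) fx /(_ I) gx _ /=.
by congr +%R.
Qed.

Lemma Lpi_scale a (f : Lf) : Lscale a (Lpi f) = Lpi (a *: f).
Proof. by apply/Lpi_eqP; apply: filterS (LpiE f) => x /(_ I) /= fx _; congr *:%R. Qed.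

Let LaddA : associative Ladd.
Proof.
move=> x y z; rewrite -[x]LreprK -[y]LreprK -[z]LreprK.
by rewrite !Lpi_add addrA.
Qed.

Let LaddC : commutative Ladd.
Proof. by move=> x y; rewrite -[x]LreprK -[y]LreprK !Lpi_add addrC. Qed.

Let Ladd0 : left_id Lzero Ladd.
Proof. by move=> x; rewrite -[x]LreprK Lpi_add add0r. Qed.

Let LaddN : left_inverse Lzero Lopp Ladd.
Proof. by move=> x; rewrite -[x]LreprK Lpi_opp Lpi_add addNr. Qed.

HB.instance Definition _ := GRing.isZmodule.Build Ls LaddA LaddC Ladd0 LaddN.

Let LscaleA a b x : Lscale a (Lscale b x) = Lscale (a * b) x.
Proof. by rewrite -[x]LreprK !Lpi_scale scalerA. Qed.

Let Lscale1 : left_id 1 Lscale.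
Proof. by move=> x; rewrite -[x]LreprK Lpi_scale scale1r. Qed.

Let LscaleDr : right_distributive Lscale +%R.
Proof.
move=> a x y; rewrite -[x]LreprK -[y]LreprK.
by rewrite /GRing.add /= !(Lpi_scale, Lpi_add) scalerDr.
Qed.

Let LscaleDl x : {morph Lscale^~ x : a b / a + b}.
Proof.
move=> a b; rewrite -[x]LreprK.
by rewrite [RHS]/GRing.add /= !(Lpi_scale, Lpi_add) scalerDl.
Qed.

HB.instance Definition _ :=
  GRing.Zmodule_isLmodule.Build R Ls LscaleA Lscale1 LscaleDr LscaleDl.

Definition Lspace_norm (x : Ls) : R := fine 'N[mu]_p[EFin \o x]%E.

Lemma Lspace_norm_pi (f : Lf) :
  Lspace_norm (Lpi f) = fine 'N[mu]_p[EFin \o f]%E.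
Proof.
rewrite /Lspace_norm (@Lnorm_ae _ f) //; last exact: LpiE.
exact: (@measurable_funPT _ _ _ _ (repr (Lpi f : Q))).
Qed.

Let Lspace_normD x y : Lspace_norm (x + y) <= Lspace_norm x + Lspace_norm y.
Proof.
rewrite -[x]LreprK -[y]LreprK /GRing.add /= Lpi_add !Lspace_norm_pi.
exact: ler_LnormD.
Qed.

Let Lspace_normZ a x : Lspace_norm (a *: x) = `|a| * Lspace_norm x.
Proof.
rewrite -[x]LreprK /GRing.scale /= Lpi_scale !Lspace_norm_pi.
by rewrite LnormZ -finite_norm_fine.
Qed.

Let Lspace_norm_eq0 x : Lspace_norm x = 0 -> x = 0.
Proof.
rewrite -[x]LreprK Lspace_norm_pi => /fine_Lnormr_eq0 x0.
exact/Lpi_eqP.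
Qed.

HB.instance Definition _ := Lmodule_isNormed.Build R Ls
  Lspace_normD Lspace_normZ Lspace_norm_eq0.

Lemma Lpi_is_linear : linear Lpi.
Proof. by move=> a f g; rewrite -Lpi_add -Lpi_scale. Qed.

Lemma Lspace_normE (x : Ls) : `|x| = fine 'N[mu]_p[EFin \o x]%E.
Proof. by []. Qed.

End Lspace_normed.

(* The measure of R that is carried by [0, 1], so that the a.e. classes on R
   are exactly the a.e. classes on [0, 1]. *)
Definition lebesgue01 (R : realType) : {measure set (measurableTypeR R) -> \bar R} :=
  mrestr (@lebesgue_measure R) (measurable_itv `[0, 1]).

Notation Lp01 R p1 := (LspaceType (lebesgue01 R) p1).

(* The infimum is over real D, hence +oo when no D is admissible.  For X with at
   least two points the D below are >= 1 and the infimum is attained if finite. *)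
Definition distortion (R : realType) (V W : normedModType R) (X : set V)
    (T : {linear V -> W}) : \bar R :=
  ereal_inf [set D%:E | D in [set D : R | exists2 s : R, 0 < s &
    forall x y, X x -> X y ->
      s * `|x - y| <= `|T x - T y| /\ `|T x - T y| <= D * s * `|x - y|]].

(* Main.v *)
Require Import Defs.
From HB Require Import structures.
From mathcomp Require Import all_boot all_order all_algebra.
From mathcomp Require Import all_classical all_reals all_analysis.
From mathcomp Require Import measurable_realfun ess_sup_inf.
From mathcomp Require Import ring.
Import Order.TTheory GRing.Theory Num.Theory.
Import numFieldNormedType.Exports.
Local Open Scope classical_set_scope.
Local Open Scope ring_scope.

(* For m = 2 ^ k let f_1, ..., f_m be the indicators of the intervals of length
   1 / m that partition [0, 1[, let H be Sylvester's Hadamard matrix of order m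
   and let w_i = sum_j H_ij f_j.  The set X consists of 0, the f_j and the w_i,
   so n = 2 m + 1.  The norm of f_j in L_p is m ^ (- 1 / p) and that of w_i is 1.
   For every linear T into L_2, the parallelogram law and induction on k give
   sum_i |T w_i| ^ 2 = m sum_j |T f_j| ^ 2.  If T has distortion D on X, with
   scale s, bounding one side below and the other side above yields, in the two
   possible ways, D ^ 2 >= m ^ (2 / p - 1) and D ^ 2 >= m ^ (1 - 2 / p). *)

(** * Sylvester's Hadamard matrices *)

(* [(-1) ^+ walsh k i j] is the (i, j) entry of Sylvester's Hadamard matrix of
   order [2 ^ k]. *)
Fixpoint walsh (k i j : nat) : bool :=
  if k is k'.+1 then
    walsh k' (i %% 2 ^ k')%N (j %% 2 ^ k')%N
      (+) ((2 ^ k' <= i)%N && (2 ^ k' <= j)%N)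
  else false.

(** The block recursion: the matrix of order 2m has blocks H, H, H, -H, where H is that of order m.
    The booleans [a] and [b] are the leading binary digits of the row and column indices. *)
Lemma walsh_block (k i j : nat) (a b : bool) : (i < 2 ^ k)%N -> (j < 2 ^ k)%N ->
  walsh k.+1 (a * 2 ^ k + i) (b * 2 ^ k + j) = walsh k i j (+) (a && b).
Proof.
move=> ik jk /=; rewrite !modnMDl !modn_small//.
have half (c : bool) (l : nat) : (l < 2 ^ k)%N -> (2 ^ k <= c * 2 ^ k + l)%N = c.
  by case: c => lk; rewrite ?mul1n ?leq_addr// mul0n add0n leqNgt lk.
by rewrite !half.
Qed.
Arguments walsh : simpl never.

(** Columns below [2 ^ k] compare the remainders of the two row indices, which agree by induction;
    column [2 ^ k] then compares the leading digits. *)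
Lemma walsh_row_inj (k i i' : nat) : (i < 2 ^ k)%N -> (i' < 2 ^ k)%N ->
  (forall j, (j < 2 ^ k)%N -> walsh k i j = walsh k i' j) -> i = i'.
Proof.
have block (l n : nat) : (l < 2 ^ n.+1)%N ->
    exists a : bool, exists2 r, (r < 2 ^ n)%N & l = (a * 2 ^ n + r)%N.
  rewrite expnS mul2n -addnn => ln; exists (2 ^ n <= l)%N.
  case: leqP => nl; [exists (l - 2 ^ n)%N|by exists l].
    by rewrite ltn_subLR.
  by rewrite mul1n subnKC.
elim: k i i' => [|k IH] i i'; first by rewrite expn0 !ltnS !leqn0 => /eqP-> /eqP->.
move=> /block[a [r rk ->]] /block[a' [r' r'k ->]] eqw.
have eqr j : (j < 2 ^ k)%N -> walsh k r j = walsh k r' j.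
  move=> jk; have := eqw (false * 2 ^ k + j)%N.
  rewrite !walsh_block// !andbF !addbF; apply.
  by rewrite mul0n add0n expnS mul2n -addnn ltn_addr.
have k0 : (0 < 2 ^ k)%N by rewrite expn_gt0.
have := eqw (true * 2 ^ k + 0)%N.
rewrite !walsh_block// !andbT (eqr 0%N k0) (IH _ _ rk r'k eqr).
rewrite mul1n addn0 expnS mul2n -addnn -[ltnLHS]addn0 ltn_add2l.
by move=> /(_ k0)/addbI->.
Qed.

(** * The Hadamard norm identity and the distortion bound *)

(** The Euclidean structure of the target enters the estimate only through this identity. *)
Definition parallelogram_law (R : realType) (W : normedModType R) :=
  forall x y : W, `|x + y| ^+ 2 + `|x - y| ^+ 2 = 2 * (`|x| ^+ 2 + `|y| ^+ 2).

(** With [A] and [B] the transforms of the two halves of [v], rows i and [2 ^ k + i] give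
    [A i + B i] and [A i - B i]. The parallelogram law reduces each such pair of rows to the
    induction hypothesis for both halves. *)
Lemma sum_walsh_sqr_norm (R : realType) (W : normedModType R) (k : nat)
    (v : nat -> W) : parallelogram_law R W ->
  \sum_(i < 2 ^ k) `|\sum_(j < 2 ^ k) (-1) ^+ walsh k i j *: v j| ^+ 2 =
  (2 ^ k)%:R * \sum_(j < 2 ^ k) `|v j| ^+ 2.
Proof.
move=> plaw; elim: k v => [|k IH] v.
  by rewrite expn0 !big_ord1 /walsh scale1r mul1r.
pose A i := \sum_(j < 2 ^ k) (-1) ^+ walsh k i j *: v j.
pose B i := \sum_(j < 2 ^ k) (-1) ^+ walsh k i j *: v (2 ^ k + j)%N.
have -> : (2 ^ k.+1 = 2 ^ k + 2 ^ k)%N by rewrite expnS mul2n -addnn.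
rewrite !big_split_ord /= mulrDr.
have top (i : 'I_(2 ^ k)) : \sum_(j < 2 ^ k + 2 ^ k)
    (-1) ^+ walsh k.+1 (lshift (2 ^ k) i) j *: v j = A i + B i.
  rewrite big_split_ord; congr (_ + _); apply: eq_bigr => j _.
    have /= := @walsh_block k i j false false (ltn_ord i) (ltn_ord j).
    by rewrite !mul0n !add0n addbF => ->.
  have /= := @walsh_block k i j false true (ltn_ord i) (ltn_ord j).
  by rewrite !mul0n !add0n mul1n addbF => ->.
have bot (i : 'I_(2 ^ k)) : \sum_(j < 2 ^ k + 2 ^ k)
    (-1) ^+ walsh k.+1 (rshift (2 ^ k) i) j *: v j = A i - B i.
  rewrite big_split_ord /= -sumrN.
  congr (_ + _); apply: eq_bigr => j _.
    have /= := @walsh_block k i j true false (ltn_ord i) (ltn_ord j).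
    by rewrite !mul0n !add0n mul1n addbF => ->.
  have /= := @walsh_block k i j true true (ltn_ord i) (ltn_ord j).
  rewrite !mul1n => ->; rewrite signr_addb. by rewrite expr1 mulrN1 scaleNr.
under eq_bigr do rewrite top.
under [X in _ + X]eq_bigr do rewrite bot.
rewrite -big_split /=; under eq_bigr do rewrite plaw.
by rewrite -mulr_sumr big_split /= (IH v) (IH (fun j => v (2 ^ k + j)%N)) natrD; ring.
Qed.

(** Here [q] stands for 1 / p; the geometry of [V] is seen only through the norms of the [e j] and
    the [w i]. *)
Lemma walsh_distortion_ge (R : realType) (V W : normedModType R) (X : set V)
    (T : {linear V -> W}) (k : nat) (e : nat -> V) (q : R) :
  let w i := \sum_(j < 2 ^ k) (-1) ^+ walsh k i j *: e j in
  parallelogram_law R W ->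
  X 0 -> (forall j, (j < 2 ^ k)%N -> X (e j)) ->
  (forall i, (i < 2 ^ k)%N -> X (w i)) ->
  (forall j, (j < 2 ^ k)%N -> `|e j| = (2 ^ k)%:R `^ (- q)) ->
  (forall i, (i < 2 ^ k)%N -> `|w i| = 1) ->
  ((((2 ^ k)%:R `^ `|q - 2^-1|)%:E : \bar R) <= distortion X T)%E.
Proof.
move=> w plaw X0 Xe Xw ne nw; apply: le_ereal_inf_tmp => _ /= [D [s s0 TX] <-].
rewrite lee_fin.
(* Comparison with the point 0 of [X] turns bounds on distances into bounds on norms. *)
have bnd x : X x -> s * `|x| <= `|T x| /\ `|T x| <= D * s * `|x|.
  by move=> Xx; have := TX x 0 Xx X0; rewrite (linear0 T) !subr0.
have := sum_walsh_sqr_norm R W k (T \o e) plaw.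
set m : R := (2 ^ k)%:R; set t := m `^ (- q) in ne.
have k0 : (0 < 2 ^ k)%N by rewrite expn_gt0.
have m0 : 0 < m by rewrite ltr0n.
(* An admissible [D] is an arbitrary real; the vector [w 0], of norm 1, forces [s <= D * s].
   Nonnegativity allows the upper bounds to be squared. *)
have D0 : 0 <= D.
  have [+ +] := bnd _ (Xw _ k0); rewrite nw// !mulr1 => h1 h2.
  by rewrite -(pmulr_lge0 _ s0) (le_trans (ltW s0))// (le_trans h1).
have Tw i : \sum_(j < 2 ^ k) (-1) ^+ walsh k i j *: (T \o e) j = T (w i).
  by rewrite linear_sum; apply: eq_bigr => j _; rewrite linearZ.
under eq_bigr do rewrite Tw.
have Ds0 : 0 <= D * s by rewrite mulr_ge0 // ltW.
have sqr_bnd x : X x -> s ^+ 2 * `|x| ^+ 2 <= `|T x| ^+ 2 /\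
    `|T x| ^+ 2 <= (D * s) ^+ 2 * `|x| ^+ 2.
  move=> /bnd[lo hi]; rewrite -!exprMn; split.
    by rewrite ler_pXn2r// nnegrE// mulr_ge0// ltW.
  by rewrite ler_pXn2r// nnegrE// mulr_ge0.
have sum_cst (c : R) : \sum_(i < 2 ^ k) c = m * c.
  by rewrite sumr_const card_ord -mulr_natl.
have Sw1 : m * s ^+ 2 <= \sum_(i < 2 ^ k) `|T (w i)| ^+ 2.
  rewrite -sum_cst; apply: ler_sum => i _.
  by have [+ _] := sqr_bnd _ (Xw _ (ltn_ord i)); rewrite nw// expr1n mulr1.
have Sw2 : \sum_(i < 2 ^ k) `|T (w i)| ^+ 2 <= m * (D * s) ^+ 2.
  rewrite -sum_cst; apply: ler_sum => i _.
  by have [_ +] := sqr_bnd _ (Xw _ (ltn_ord i)); rewrite nw// expr1n mulr1.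
have Se1 : m * (s ^+ 2 * t ^+ 2) <= \sum_(j < 2 ^ k) `|T (e j)| ^+ 2.
  rewrite -sum_cst; apply: ler_sum => j _.
  by have [+ _] := sqr_bnd _ (Xe _ (ltn_ord j)); rewrite ne.
have Se2 : \sum_(j < 2 ^ k) `|T (e j)| ^+ 2 <= m * ((D * s) ^+ 2 * t ^+ 2).
  rewrite -sum_cst; apply: ler_sum => j _.
  by have [_ +] := sqr_bnd _ (Xe _ (ltn_ord j)); rewrite ne.
move=> eqS.
(* [u] is the sum of the squared norms of the [e j]. *)
pose u := m `^ (1 - 2 * q).
have uE : u = m * t ^+ 2.
  rewrite /u powRD; last by rewrite (gt_eqF m0) implybT.
  by rewrite powRr1 ?ltW// mulrC (mulrC 2) -mulNr powRrM powR_mulrn ?powR_ge0// mulrC.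
have s20 : 0 < s ^+ 2 by rewrite exprn_gt0.
(* Lower bounds for the [T (e j)] against upper bounds for the [T (w i)]. *)
have uD : u <= D ^+ 2.
  have : m * (m * (s ^+ 2 * t ^+ 2)) <= m * (D * s) ^+ 2.
    by rewrite (le_trans _ Sw2)// eqS ler_pM2l.
  rewrite ler_pM2l// exprMn (_ : m * _ = u * s ^+ 2) ?ler_pM2r//.
  by rewrite uE; ring.
(* The reverse comparison. *)
have uD1 : 1 <= u * D ^+ 2.
  have : m * s ^+ 2 <= m * (m * ((D * s) ^+ 2 * t ^+ 2)).
    by rewrite (le_trans Sw1)// eqS ler_pM2l.
  rewrite ler_pM2l// exprMn (_ : m * _ = u * D ^+ 2 * s ^+ 2).
    by rewrite -[leLHS]mul1r ler_pM2r.
  by rewrite uE; ring.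
(* After squaring, the left side is the inverse of [u] if q >= 1/2 and [u] otherwise. *)
rewrite -(@ler_pXn2r _ 2)// ?nnegrE ?powR_ge0// -powR_mulrn ?powR_ge0// -powRrM.
have [q2|q2] := ger0P (q - 2^-1).
  rewrite (_ : (q - 2^-1) * 2%:R = - (1 - 2 * q)); last by field.
  by rewrite powRN -/u -[leLHS]mul1r ler_pdivrMr ?powR_gt0// mulrC.
by rewrite (_ : - (q - 2^-1) * 2%:R = 1 - 2 * q)//; field.
Qed.

(** * The parallelogram law in L_2 *)

(** The pointwise identity for real numbers is integrated; all integrands are nonnegative, so
    additivity of the integral asks only for measurability. *)
Lemma Lspace2_parallelogram d (T : measurableType d) (R : realType)
    (mu : {measure set T -> \bar R}) :
  parallelogram_law R (LspaceType mu (lee1n 2)).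
Proof.
have sqr_norm (f : LfunType mu (lee1n 2)) :
    ((`|Lpi f| ^+ 2)%:E = \int[mu]_x ((f x) ^+ 2)%:E)%E.
  rewrite [in LHS]/Num.Def.normr /= Lspace_norm_pi -powR_mulrn ?fine_ge0 ?Lnorm_ge0//.
  rewrite -poweR_EFin finite_norm_fine poweR_Lnorm ?pnatr_eq0//.
  apply: eq_integral => x _.
  by rewrite /= powR_mulrn// real_normK ?num_real.
have msqr (h : LfunType mu (lee1n 2)) :
    measurable_fun setT (EFin \o (fun x => h x ^+ 2)).
  by apply/measurable_EFinP; apply: measurable_funX.
have sqr_ge (h : LfunType mu (lee1n 2)) x : setT x -> (0 <= (h x ^+ 2)%:E)%E.
  by rewrite lee_fin sqr_ge0.
have intD (f g : LfunType mu (lee1n 2)) :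
    (`|Lpi f| ^+ 2 + `|Lpi g| ^+ 2)%:E =
      (\int[mu]_x ((f x ^+ 2)%:E + (g x ^+ 2)%:E))%E.
  by rewrite EFinD !sqr_norm (ge0_integralD _ _ (sqr_ge f) (msqr f) (sqr_ge g) (msqr g)).
move=> x y; rewrite -[x]LreprK -[y]LreprK.
set f := Lrepr x; set g := Lrepr y.
have -> : Lpi f + Lpi g = Lpi (f + g) by rewrite -Lpi_add.
have -> : Lpi f - Lpi g = Lpi (f - g) by rewrite -Lpi_add -Lpi_opp.
apply: EFin_inj; rewrite EFinM !intD -ge0_integralZl//.
- apply: eq_integral => z _; rewrite -!EFinD -EFinM; congr EFin.
  have -> : (f + g) z = f z + g z by [].
  have -> : (f - g) z = f z - g z by [].
  by move: (f z) (g z) => a b; ring.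
- by apply: emeasurable_funD; exact: msqr.
- by move=> z _; rewrite adde_ge0// lee_fin sqr_ge0.
Qed.

(** * Norms of functions whose absolute value is an indicator *)

(** If [P] failed throughout [A], then [A] would be negligible. This allows almost everywhere
    statements to be evaluated at a point of [A]. *)
Lemma ae_witness d (T : measurableType d) (R : realType)
    (mu : {measure set T -> \bar R}) (A : set T) (P : T -> Prop) :
  (0 < mu A)%E -> d.-measurable A -> {ae mu, forall x, P x} -> exists2 x, A x & P x.
Proof.
move=> muA mA aeP; apply: contrapT => /forall2NP noP.
have /(negligibleP _ mA) muA0 : mu.-negligible A.
  apply: negligibleS aeP => x Ax /= Px.
  by have [] := noP x.
by rewrite muA0 ltxx in muA.
Qed.

(** One computation serves both the [f_j], with [A] a cell, and the [w_i], with [A] the whole of [0,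
    1[. *)
Lemma Lnorm_abs_indic d (T : measurableType d) (R : realType)
    (mu : {measure set T -> \bar R}) (p : \bar R) (A : set T) (a : R) (f : T -> R) :
  (1 <= p)%E -> d.-measurable A -> 0 < a -> mu A = a%:E ->
  (forall x, `|f x| = \1_A x) ->
  'N[mu]_p[EFin \o f]%E = (a `^ fine p^-1%E)%:E.
Proof.
move=> p1 mA a0 muA fA; rewrite unlock; case: p p1 => [r r1||//].
  have r0 : r != 0 by rewrite gt_eqF// (lt_le_trans ltr01).
  rewrite inver (negbTE r0) -poweR_EFin -muA /=.
  rewrite -[in RHS](setIT A) -integral_indic//; congr (_ `^ _)%E.
  apply: eq_integral => x _; rewrite fA indicE.
  by case: (x \in A); rewrite /= ?powR1// powR0.
(* Case [p = +oo]: the exponent 1 / p is 0, so the norm must be 1. It is given by an essential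
   supremum when the space has positive measure, whence [T0]. *)
have A0 : (0 < mu A)%E by rewrite muA lte_fin.
have T0 : (0 < mu setT)%E by rewrite (lt_le_trans A0)// le_measure ?inE.
move=> _; rewrite T0 invey /= powRr0; apply/eqP; rewrite eq_le; apply/andP; split.
  apply/ess_supP/nearW => x /=; rewrite fA indicE.
  by case: (x \in A); rewrite lee_fin.
(* The essential bound holds at some point of [A], where |f| = 1. *)
have [x Ax] := @ae_witness _ _ _ mu _ _ A0 mA (ess_sup_ge mu (abse \o (EFin \o f))).
by rewrite /= fA indicE mem_set.
Qed.

(** * The partition of [0, 1[ into m cells *)

Definition cell (R : realType) (m j : nat) : set (measurableTypeR R) :=
  `[j%:R / m%:R, j.+1%:R / m%:R[.

Lemma cellE (R : realType) (m j : nat) (x : R) : (0 < m)%N ->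
  cell R m j x <-> j%:R <= x * m%:R < j.+1%:R.
Proof.
move=> m0; rewrite /cell /= in_itv /= ler_pdivrMr ?ltr0n// ltr_pdivlMr ?ltr0n//.
Qed.

Lemma cell_inj (R : realType) (m i j : nat) (x : R) : (0 < m)%N ->
  cell R m i x -> cell R m j x -> i = j.
Proof.
move=> m0 /(cellE _ _ _ _ m0)/andP[i1 i2] /(cellE _ _ _ _ m0)/andP[j1 j2].
have := le_lt_trans i1 j2; have := le_lt_trans j1 i2.
by rewrite !ltr_nat !ltnS => ? ?; apply/eqP; rewrite eqn_leq; apply/andP.
Qed.

Lemma cell_subset (R : realType) (m j : nat) : (j < m)%N -> cell R m j `<=` `[0, 1[%classic.
Proof.
move=> jm x; have m0 := leq_ltn_trans (leq0n j) jm.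
move=> /(cellE _ _ _ _ m0)/andP[j1 j2] /=; rewrite in_itv /=.
have mR : (0 : R) < m%:R by rewrite ltr0n.
rewrite -(pmulr_lge0 _ mR) (le_trans _ j1) ?ler0n//=.
by rewrite -(ltr_pM2r mR) mul1r (lt_le_trans j2)// ler_nat.
Qed.

Lemma cell_cover (R : realType) (m : nat) (x : R) : (0 < m)%N -> `[0, 1[%classic x ->
  exists2 j, (j < m)%N & cell R m j x.
Proof.
move=> m0; rewrite /= in_itv /= => /andP[x0 x1].
have mR : (0 : R) < m%:R by rewrite ltr0n.
have xm0 : 0 <= x * m%:R by rewrite mulr_ge0// ltW.
have /andP[t1 t2] := truncn_itv xm0.
exists (Num.trunc (x * m%:R)); last by apply/cellE => //; rewrite t1.
by rewrite -(ltr_nat R) (le_lt_trans t1)// -[ltRHS]mul1r ltr_pM2r.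
Qed.

Lemma lebesgue01_itv (R : realType) (a b : R) : 0 <= a -> a < b -> b <= 1 ->
  lebesgue01 R `[a, b[%classic = (b - a)%:E.
Proof.
move=> a0 ab b1.
rewrite /lebesgue01 /= /mrestr setIidl; last first.
  move=> x /=; rewrite !in_itv /= => /andP[ax xb].
  by rewrite (le_trans a0 ax) (le_trans (ltW xb)).
by rewrite lebesgue_measure_itv /= lte_fin ab EFinB.
Qed.

Lemma lebesgue01_cell (R : realType) (m j : nat) : (j < m)%N ->
  lebesgue01 R (cell R m j) = m%:R^-1%:E.
Proof.
move=> jm; have mR : (0 : R) < m%:R by rewrite ltr0n (leq_ltn_trans _ jm).
rewrite lebesgue01_itv.
- by rewrite -mulrBl -natr1 addrAC subrr add0r mul1r.
- by rewrite divr_ge0.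
- by rewrite ltr_pM2r ?invr_gt0// ltr_nat.
- by rewrite ler_pdivrMr// mul1r ler_nat.
Qed.

Lemma measurable_cell (R : realType) (m j : nat) : measurable (cell R m j).
Proof. exact: measurable_itv. Qed.

(** * Step functions in L_p *)

(** An indicator is bounded, and for a finite measure L_oo is contained in L_p. *)
Lemma indic_Lfun d (T : measurableType d) (R : realType)
    (mu : {measure set T -> \bar R}) (p : \bar R) (A : set T) :
  (1 <= p)%E -> mu setT \is a fin_num -> d.-measurable A ->
  (\1_A : T -> R) \in Lfun mu p.
Proof.
move=> p1 muT mA.
apply: (@Lfun_subset _ _ _ mu p +oo p1 (leey _) muT (leey _)).
rewrite inE; apply/andP; split; rewrite inE /=; first exact: measurable_indic.
rewrite /finite_norm unlock; case: ifPn => // _.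
apply: (@le_lt_trans _ _ 1%E); last exact: ltry.
apply/ess_supP/nearW => x /=; rewrite indicE.
by case: (x \in A); rewrite lee_fin ?normr1 ?normr0.
Qed.

Lemma lebesgue01_setT_fin_num (R : realType) : lebesgue01 R setT \is a fin_num.
Proof. by rewrite /lebesgue01 /= /mrestr setTI lebesgue_measure_itv /= lte_fin ltr01. Qed.

Lemma Lpi_sumZ d (T : measurableType d) (R : realType)
    (mu : {measure set T -> \bar R}) (p : \bar R) (p1 : (1 <= p)%E) (m : nat)
    (c : nat -> R) (f : nat -> LfunType mu p1) :
  Lpi (\sum_(j < m) c j *: f j) = \sum_(j < m) c j *: Lpi (f j).
Proof.
rewrite (@big_morph _ _ (@Lpi _ _ _ mu p p1) 0 +%R 0 +%R)//.
  by apply: eq_bigr => j _; rewrite -Lpi_scale.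
by move=> x y; rewrite -Lpi_add.
Qed.

Section cell_functions.
Context (R : realType) (p : \bar R) (p1 : (1 <= p)%E) (m : nat).

Definition cell_fun (j : nat) : LfunType (lebesgue01 R) p1 :=
  Lfun_Sub p1 (indic_Lfun _ _ _ _ _ _ p1 (lebesgue01_setT_fin_num R)
                 (measurable_cell R m j)).

Definition step (c : nat -> R) : LfunType (lebesgue01 R) p1 :=
  \sum_(j < m) c j *: cell_fun j.

Lemma stepE (c : nat -> R) (x : R) : step c x = \sum_(j < m) c j * \1_(cell R m j) x.
Proof.
by rewrite /step (big_morph (fun f : LfunType (lebesgue01 R) p1 => f x)
  (id1 := 0) (op1 := +%R)).
Qed.

Lemma step_cell (c : nat -> R) (j : nat) (x : R) : (j < m)%N -> cell R m j x ->
  step c x = c j.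
Proof.
move=> jm xj; have m0 := leq_ltn_trans (leq0n j) jm.
rewrite stepE (bigD1 (Ordinal jm))//= indicE mem_set// mulr1 big1 ?addr0// => i ij.
rewrite indicE memNset ?mulr0// => xi; move/eqP: ij; apply.
by apply: val_inj; apply: cell_inj xi xj.
Qed.

Lemma step_out (c : nat -> R) (x : R) : ~ `[0, 1[%classic x -> step c x = 0.
Proof.
move=> x01; rewrite stepE big1// => j _.
by rewrite indicE memNset ?mulr0// => /(cell_subset _ _ _ (ltn_ord j)).
Qed.

(** Each cell has positive measure, so functions equal almost everywhere agree at some point of
    it. *)
Lemma step_eq (c c' : nat -> R) : Lpi (step c) = Lpi (step c') ->
  forall j, (j < m)%N -> c j = c' j.
Proof.
move=> /Lpi_eqP cc' j jm.
have cell0 : (0 < lebesgue01 R (cell R m j))%E.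
  by rewrite lebesgue01_cell// lte_fin invr_gt0 ltr0n (leq_ltn_trans _ jm).
have [x xj /(_ I)] := ae_witness _ _ _ _ _ _ cell0 (measurable_cell R m j) cc'.
by rewrite !(step_cell _ _ _ jm xj).
Qed.

Lemma norm_cell_fun (j : nat) : (j < m)%N ->
  `|Lpi (cell_fun j)| = m%:R `^ (- fine p^-1%E).
Proof.
move=> jm; have mR : (0 : R) < m%:R by rewrite ltr0n (leq_ltn_trans _ jm).
rewrite [in LHS]/Num.Def.normr /= Lspace_norm_pi.
rewrite (Lnorm_abs_indic _ _ _ _ _ _ m%:R^-1 _ p1 (measurable_cell R m j)).
- by rewrite /= -powR_inv1 ?ltW// -powRrM mulN1r.
- by rewrite invr_gt0.
- exact: lebesgue01_cell.
- by move=> x; rewrite indicE ger0_norm.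
Qed.

(** The absolute value is the indicator of [0, 1[, which has measure 1, so the norm is 1 for every
    p. *)
Lemma norm_step_unimodular (c : nat -> R) : (0 < m)%N ->
  (forall j, (j < m)%N -> `|c j| = 1) -> `|Lpi (step c)| = 1.
Proof.
move=> m0 c1; rewrite [in LHS]/Num.Def.normr /= Lspace_norm_pi.
rewrite (Lnorm_abs_indic _ (measurableTypeR R) _ _ _ `[0, 1[%classic 1 _ p1
  (measurable_itv _)) ?powR1//.
- by rewrite lebesgue01_itv// subr0.
- move=> x; rewrite indicE.
  have [x01|x01] := pselect (`[0, 1[%classic x).
    have [j jm xj] := cell_cover _ _ _ m0 x01.
    by rewrite (step_cell _ _ _ jm xj) c1// mem_set.
  by rewrite step_out// normr0 memNset.
Qed.

End cell_functions.

(** * The set X and the conclusion *)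

(* Rows [n < m] are those of the Hadamard matrix of order [m = 2 ^ k], rows
   [m, ..., 2 m - 1] the unit vectors, and row [2 m] is zero. *)
Definition walsh_unit (R : realType) (k n j : nat) : R :=
  if (n < 2 ^ k)%N then (-1) ^+ walsh k n j else (j == n - 2 ^ k)%N%:R.

(** Sign rows have no zero entry, while the other rows have one as soon as m >= 2. For m = 1 the
    sign row would equal the unit vector, hence the order [2 ^ k.+1]. *)
Lemma walsh_unit_inj (R : realType) (k n n' : nat) :
  (n <= 2 ^ k.+1 + 2 ^ k.+1)%N -> (n' <= 2 ^ k.+1 + 2 ^ k.+1)%N ->
  (forall j, (j < 2 ^ k.+1)%N -> walsh_unit R k.+1 n j = walsh_unit R k.+1 n' j) ->
  n = n'.
Proof.
have m2 : (1 < 2 ^ k.+1)%N by rewrite -[ltnLHS](expn0 2) ltn_exp2l.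
rewrite /walsh_unit; move: m2; set m := (2 ^ k.+1)%N => m2 nm n'm.
have signN0 b (i : nat) : exists2 j, (j < m)%N & (-1 : R) ^+ walsh k.+1 b j <> (j == i)%:R.
  (* Column 1 if i = 0 and column 0 otherwise: a column other than i. *)
  exists (i == 0)%N; first by case: (i == 0)%N; rewrite // (ltn_trans _ m2).
  by case: i => [|i] /=; apply/eqP; rewrite signr_eq0.
case: ltnP => [ltn|gen]; case: ltnP => [ltn'|gen'] eqc.
- apply: (@walsh_row_inj k.+1) => // j jm; have := eqc j jm.
  by move/eqP; rewrite (inj_eq (@signr_inj R)) => /eqP.
- by have [j jm []] := signN0 n (n' - m)%N; exact: eqc.
- by have [j jm []] := signN0 n' (n - m)%N; rewrite -eqc.
have unit_eq a b : (a < m)%N -> (a == a)%:R = (a == b)%:R :> R -> a = b.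
  by rewrite eqxx; case: eqVneq => // _ _ /eqP; rewrite oner_eq0.
rewrite -(subnK gen) -(subnK gen'); congr addn.
have : (n - m <= m)%N by rewrite leq_subLR.
have : (n' - m <= m)%N by rewrite leq_subLR.
(* The offset m marks the zero row; any smaller offset is a column at which the two rows can be
   compared. *)
rewrite leq_eqVlt => /predU1P[n'E|n'lt]; last first.
  by move=> _; apply/esym/unit_eq => //; rewrite eqc.
rewrite leq_eqVlt => /predU1P[->//|nlt].
by apply: unit_eq => //; rewrite eqc.
Qed.

Theorem lemma3p1 (R : realType) (p : \bar R) (p1 : (1 <= p)%E) (N : nat) :
  exists2 n : nat, (N <= n)%N &
  exists2 X : set (Lp01 R p1), (X #= `I_n)%card &
  forall T : {linear Lp01 R p1 -> Lp01 R (lee1n 2)},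
    (((((n%:R - 1) / 2) `^ `|fine p^-1%E - 2^-1|)%:E : \bar R)
       <= distortion X T)%E.
Proof.
(* The order m exceeds [N], and k > 0 gives m >= 2, which makes the points distinct. *)
pose k := N.+1; pose m := (2 ^ k)%N.
have m0 : (0 < m)%N by rewrite expn_gt0.
pose e j : Lp01 R p1 := Lpi (cell_fun R p p1 m j).
pose pt n : Lp01 R p1 := Lpi (step R p p1 m (walsh_unit R k n)).
exists (m + m).+1.
  apply: leqW; apply: leq_trans (leq_addr _ _).
  by rewrite ltnW// (leq_trans (ltnSn N))// ltnW// ltn_expl.
exists (pt @` `I_(m + m).+1).
  apply: inj_card_eq => n n'; rewrite !inE /= !ltnS => nm n'm /step_eq.
  exact: walsh_unit_inj.
move=> T.
have -> : ((m + m).+1%:R - 1) / 2 = m%:R :> R.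
  by rewrite -natr1 addrK natrD; field.
have ptE n : pt n = \sum_(j < m) walsh_unit R k n j *: e j by rewrite /pt Lpi_sumZ.
have pt_walsh i : (i < m)%N -> \sum_(j < m) (-1) ^+ walsh k i j *: e j = pt i.
  by move=> im; rewrite ptE /walsh_unit im.
have pt_unit j : (j < m)%N -> pt (m + j)%N = e j.
  move=> jm; rewrite ptE (bigD1 (Ordinal jm))//= big1 => [|i ij].
    by rewrite /walsh_unit ltnNge leq_addr addKn eqxx scale1r addr0.
  rewrite /walsh_unit ltnNge leq_addr addKn (_ : (i == j :> nat) = false) ?scale0r//.
  by apply: contraNF ij => /eqP ij; apply/eqP/val_inj.
(* The offset m is not the index of any column, so all coefficients vanish. *)
have pt_zero : pt (m + m)%N = 0.
  rewrite ptE big1// => i _.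
  by rewrite /walsh_unit ltnNge leq_addr addKn ltn_eqF// scale0r.
apply: (@walsh_distortion_ge R _ _ _ T k e).
- exact: Lspace2_parallelogram.
- by exists (m + m)%N => //=.
- by move=> j jm; exists (m + j)%N; rewrite ?pt_unit//= ltnS leq_add2l ltnW.
- move=> i im; rewrite pt_walsh//; exists i => //=.
  by rewrite ltnS (leq_trans (ltnW im))// leq_addr.
- by move=> j; exact: norm_cell_fun.
- move=> i im; rewrite pt_walsh//; apply: norm_step_unimodular => // j _.
  by rewrite /walsh_unit im normr_sign.
Qed.
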